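(* For problems $P$, $Q$, $P\leq_2 Q$ implies $\operatorname{bas}(P)\leq\operatorname{bas}(Q)$.
   Context: A partial function $F:\subseteq X\to Y$ is continuous if continuous on $\operatorname{dom}(F)$ with the subspace topology. A problem $P:\underline{X}\to\underline{Y}$ is a set of partial functions. For problems $P:\underline{X}_1\to\underline{Y}_1$, $Q:\underline{X}_2\to\underline{Y}_2$, $P\leq_2 Q$ means there are continuous partial $F:\subseteq\underline{X}_1\times\underline{Y}_2\to\underline{Y}_1$, $G:\subseteq\underline{X}_1\to\underline{X}_2$ with $(x\mapsto F(x,g(G(x))))\in P$ for all $g\in Q$. A partition for a (partial) function $f$ is a partition $p$ of its domain such that $f|_U$ is continuous for every $U\in p$; $\operatorname{bas}(f)$ is the least cardinality of a partition for $f$. For a problem $P$, $\operatorname{bas}(P)=\min\{\operatorname{bas}(f)\mid f\in P\}$ (the minimum of an empty collection being regarded as a value larger than all cardinals). *)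

(* Defs.v *)
From HB Require Import structures.
From mathcomp Require Import all_boot all_order all_algebra.
From mathcomp Require Import all_classical.
From mathcomp Require Import topology.

Set Implicit Arguments.
Unset Strict Implicit.
Unset Printing Implicit Defensive.

Local Open Scope classical_set_scope.
Local Open Scope card_scope.

(* [f x = None] means that [f] is undefined at [x]. *)
Definition pfun (X Y : Type) : Type := X -> option Y.

Definition dom (X Y : Type) (f : pfun X Y) : set X :=
  [set x | exists y, f x = Some y].

Definition pval (X Y : Type) (f : pfun X Y) (x : dom f) : Y :=
  sval (cid (set_valP x)).

Lemma pvalE (X Y : Type) (f : pfun X Y) (x : dom f) :
  f (val x) = Some (pval x).
Proof. exact: (svalP (cid (set_valP x))). Qed.

(* The type [dom f] carries the initial topology of its inclusion into [X],
   that is, the subspace topology. *)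
Definition pcontinuous (X Y : topologicalType) (f : pfun X Y) : Prop :=
  continuous (@pval X Y f).

Definition prestrict (X Y : Type) (f : pfun X Y) (U : set X) : pfun X Y :=
  fun x => if x \in U then f x else None.

Definition problem (X Y : Type) : Type := set (pfun X Y).

(* x |-> F (x, g (G x)), defined exactly where all three applications are. *)
Definition transfer (X1 Y1 X2 Y2 : Type) (F : pfun (X1 * Y2) Y1)
    (G : pfun X1 X2) (g : pfun X2 Y2) : pfun X1 Y1 :=
  fun x => if G x is Some z then
             if g z is Some y then F (x, y) else None
           else None.

Definition le2 (X1 Y1 X2 Y2 : topologicalType)
    (P : problem X1 Y1) (Q : problem X2 Y2) : Prop :=
  exists (F : pfun (X1 * Y2)%type Y1) (G : pfun X1 X2),
    [/\ pcontinuous F, pcontinuous G & forall g, Q g -> P (transfer F G g)].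

Definition partition_for (X Y : topologicalType) (f : pfun X Y)
    (p : set (set X)) : Prop :=
  partition p id (dom f) /\ forall U, p U -> pcontinuous (prestrict f U).

Lemma partition_for_set1 (X Y : topologicalType) (f : pfun X Y) :
  partition_for f [set [set x] | x in dom f].
Proof.
split.
  split.
  - rewrite /cover; apply/seteqP; split=> [x [_ [y fy <-] /= ->//]|x fx].
    by exists [set x] => //; exists x.
  - by move=> _ _ [x _ <-] [y _ <-] [z [/= <- <-]].
  - by move=> _ [x _ <-]; exists x.
move=> _ [a _ <-] x V /= /nbhs_singleton Vx.
change (nbhs x (pval (f:=prestrict f [set a]) @^-1` V)).
have sub1 (y : dom (prestrict f [set a])) : val y = a.
  have := set_valP y; rewrite /dom /prestrict /= => -[z].
  by case: ifPn => // /set_mem.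
rewrite (_ : _ @^-1` _ = setT); first exact: filterT.
apply/seteqP; split=> // y _ /=.
by rewrite (_ : y = x) //; apply: val_inj; rewrite !sub1.
Qed.

(* Cardinals are represented by types, compared by the existence of an
   injection: [[set: A] #<= [set: B]].

   The cardinals of a nonempty family have a least element: take a maximal set
   of choice functions for the family that pairwise differ at every index; it
   injects into each member of the family, and some member injects into it. *)
Lemma ex_least_card (I : Type) (D : set I) (c : I -> Type) : D !=set0 ->
  exists i, D i /\ forall j, D j -> [set: c i] #<= [set: c j].
Proof.
move=> D0.
pose T := forall i : D, c (val i).
pose sep (S : set T) := forall s t, S s -> S t -> forall i, s i = t i -> s = t.
have [S [Ssep Smax]] : exists S : set T, sep S /\
    forall S', S `<` S' -> ~ sep S'.
  apply: Zorn_bigcup => F Fsep Ftot s t [A FA As] [B FB Bt].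
  have [AB|BA] := Ftot _ _ FA FB.
    by apply: (Fsep _ FB) => //; exact: AB.
  by apply: (Fsep _ FA) => //; exact: BA.
have [[i isurj]|nsurj] :=
    pselect (exists i : D, forall a : c (val i), exists s, S s /\ s i = a).
  exists (val i); split; first exact: set_valP.
  move=> j Dj; pose j' : D := SigSub (mem_set Dj).
  pose h (a : c (val i)) : c j := sval (cid (isurj a)) j'.
  apply: inj_card_le; apply: unsquash; apply/injfunPex.
  exists h => // a b _ _.
  rewrite /h; case: (cid (isurj a)) => s /= [Ss <-].
  case: (cid (isurj b)) => t /= [St <-] st.
  by rewrite (Ssep s t Ss St j' st).
have missed (i : D) : exists a : c (val i), forall s, S s -> s i <> a.
  apply: contrapT => /forallNP missed; apply: nsurj; exists i => a.
  apply: contrapT => /forallNP noa; apply: (missed a) => s Ss sia.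
  exact: (noa s).
pose n : T := fun i => sval (cid (missed i)).
have nP i s : S s -> s i <> n i by move=> /(svalP (cid (missed i))).
have [i0 Di0] := D0; pose d : D := SigSub (mem_set Di0).
exfalso; apply: (Smax (S `|` [set n])).
  split; first by left.
  by move=> /(_ n (or_intror erefl)) /(nP d).
move=> s t [Ss|->] [St|->] i //.
- exact: Ssep.
- by move/(nP i _ Ss).
- by move/esym/(nP i _ St).
Qed.

Definition least_card (I : Type) (D : set I) (c : I -> Type)
  (D0 : D !=set0) : Type := c (sval (cid (@ex_least_card I D c D0))).

Definition pfun_bas (X Y : topologicalType) (f : pfun X Y) : Type :=
  least_card (fun p : set (set X) => set_type p)
    (ex_intro _ _ (partition_for_set1 f)).

(* [None] is the value larger than all cardinals. *)
Definition ecard : Type := option Type.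

Definition ecard_le (k l : ecard) : Prop :=
  match k, l with
  | _, None => True
  | None, Some _ => False
  | Some A, Some B => [set: A] #<= [set: B]
  end.

Definition bas (X Y : topologicalType) (P : problem X Y) : ecard :=
  match pselect (P !=set0) with
  | left P0 => Some (least_card (@pfun_bas X Y) P0)
  | right _ => None
  end.

(* Main.v *)
(** If [g] in [Q] has a partition [p] into continuity pieces, the nonempty sets
    among [{x in dom f | G x in U}], for [U] in [p], partition the domain of
    [f x = F (x, g (G x))] into continuity pieces of [f]; distinct pieces come
    from distinct [U], so there are at most as many as elements of [p]. *)
Require Import Defs.
From mathcomp Require Import all_boot all_classical.
From mathcomp Require Import topology.

Set Implicit Arguments.
Unset Strict Implicit.
Unset Printing Implicit Defensive.

Local Open Scope classical_set_scope.
Local Open Scope card_scope.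

(** Subspace neighbourhoods are traces of neighbourhoods in [X]. Restrictions with different domains
    can thus all be handled in [X], without passing through the types [dom f]. *)
Lemma pcontinuousP (X Y : topologicalType) (f : pfun X Y) :
  pcontinuous f <->
  forall x y, f x = Some y -> forall W, nbhs y W ->
    \forall x' \near x, forall y', f x' = Some y' -> W y'.
Proof.
split=> [fc x y fxy W yW|fc x W].
- have dx : x \in dom f by apply/mem_set; exists y.
  pose x0 : dom f := SigSub dx.
  have x0y : pval x0 = y by move: (pvalE x0); rewrite /= fxy => -[].
  have /= := fc x0 W; rewrite x0y => /(_ yW) [_ [[B Bo <-] /= Bx BW]].
  apply: filterS (open_nbhs_nbhs (conj Bo Bx)) => x' Bx' y' fx'.
  have dx' : x' \in dom f by apply/mem_set; exists y'.
  have /= := BW (SigSub dx') Bx'.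
  by move: (pvalE (SigSub dx')); rewrite /= fx' => -[->].
- move=> /(fc _ _ (pvalE x)) /(@initial_continuous _ _ (@set_val _ (dom f)) x).
  by apply: (@filterS _ (nbhs x)) => x' /(_ _ (pvalE x')).
Qed.

Lemma least_card_le (I : Type) (D : set I) (c : I -> Type) (D0 : D !=set0) j :
  D j -> [set: least_card c D0] #<= [set: c j].
Proof.
by rewrite /least_card; case: (cid _) => i [Di /=]; apply.
Qed.

Lemma least_card_attained (I : Type) (D : set I) (c : I -> Type)
    (D0 : D !=set0) :
  exists2 i, D i & [set: c i] #<= [set: least_card c D0].
Proof.
by rewrite /least_card; case: (cid _) => i [Di lei] /=; exists i.
Qed.

Lemma transfer_SomeP (X1 Y1 X2 Y2 : Type) (F : pfun (X1 * Y2) Y1)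
    (G : pfun X1 X2) (g : pfun X2 Y2) x y :
  transfer F G g x = Some y <->
  exists z w, [/\ G x = Some z, g z = Some w & F (x, w) = Some y].
Proof.
rewrite /transfer; split=> [|[z [w [-> -> ->]]] //].
by case: (G x) => // z; case gz: (g z) => [w|] // Fxw; exists z, w.
Qed.

Lemma prestrict_SomeP (X Y : Type) (f : pfun X Y) (U : set X) x y :
  prestrict f U x = Some y <-> U x /\ f x = Some y.
Proof.
rewrite /prestrict; split=> [|[Ux fx]]; last by rewrite mem_set.
by case: ifPn => // /set_mem.
Qed.

(** Choose a preimage in [p] for each element of [q]; since [h] is a function, distinct elements get
    distinct preimages. *)
Lemma set_type_sub_image_le (S T : Type) (h : S -> T) (p : set S) (q : set T) :
  q `<=` h @` p -> [set: set_type q] #<= [set: set_type p].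
Proof.
move=> qhp.
have pick (V : set_type q) : exists U : set_type p, h (val U) = val V.
  by have [U pU hU] := qhp _ (set_valP V); exists (SigSub (mem_set pU)).
apply: inj_card_le; apply: unsquash; apply/injfunPex.
exists (fun V => sval (cid (pick V))) => // V W _ _.
case: (cid (pick V)) => U /= UV; case: (cid (pick W)) => U' /= UW UU'.
by apply: val_inj; apply: etrans (esym UV) _; rewrite UU'.
Qed.

Section Transfer.
Context (X1 Y1 X2 Y2 : topologicalType).
Context (F : pfun (X1 * Y2)%type Y1) (G : pfun X1 X2) (g : pfun X2 Y2).
Hypotheses (Fc : pcontinuous F) (Gc : pcontinuous G).

(** The preimage of [U] under [G] may leave the domain of the composite, hence the first
    conjunct. *)
Definition transfer_piece (U : set X2) : set X1 :=
  [set x | dom (transfer F G g) x /\ exists2 z, G x = Some z & U z].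

Lemma transfer_piece_continuous (U : set X2) :
  pcontinuous (prestrict g U) ->
  pcontinuous (prestrict (transfer F G g) (transfer_piece U)).
Proof.
move=> /pcontinuousP gc; apply/pcontinuousP => x y.
move=> /prestrict_SomeP [[_ [z Gx Uz]] /transfer_SomeP].
rewrite Gx => -[_ [w [[<-] gz Fxw]]] W yW.
have [[A B] /= [xA wB] ABW] := (pcontinuousP _).1 Fc _ _ Fxw _ yW.
have gUz : prestrict g U z = Some w by apply/prestrict_SomeP.
(* The neighbourhood [B] of [w] is pulled back first along [g] restricted to [U], then along [G]. *)
have xG := (pcontinuousP _).1 Gc _ _ Gx _ (gc _ _ gUz _ wB).
near=> x' => y' /prestrict_SomeP [[_ [z' Gx' Uz']] /transfer_SomeP].
rewrite Gx' => -[_ [w' [[<-] gz' Fxw']]].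
apply: (ABW (x', w')) => //; split=> /=; first by near: x'.
(* As [z'] lies in [U], the restriction of [g] is defined there with value [w'], so its continuity
   applies. *)
have := near xG x' => /(_ _ _ Gx'); apply=> //.
by apply/prestrict_SomeP.
Unshelve. all: by end_near. Qed.

Lemma partition_for_transfer (p : set (set X2)) : partition_for g p ->
  partition_for (transfer F G g)
    (transfer_piece @` [set U | p U /\ transfer_piece U !=set0]).
Proof.
move=> [[pcover ptriv _] pc]; split; last first.
  by move=> _ [U [pU _] <-]; apply/transfer_piece_continuous/pc.
split; last by move=> _ [U [_ ?] <-].
- apply/seteqP; split=> [x [_ [U _ <-] []] //|x dx].
  have [y /transfer_SomeP [z [w [Gx gz _]]]] := dx.
  have : dom g z by exists w.
  rewrite -pcover => -[U pU Uz].
  have Vx : transfer_piece U x by split=> //; exists z.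
  by exists (transfer_piece U) => //; exists U => //; split=> //; exists x.
(* At a common point [x] of two pieces, the single value [G x] lies in both [U] and [U'], so these
   coincide by disjointness of [p]. *)
- move=> _ _ [U [pU _] <-] [U' [pU' _] <-] [x [[_ [z Gx Uz]] [_ [z']]]].
  rewrite Gx => -[<-] U'z; congr transfer_piece.
  by apply: ptriv => //; exists z.
Qed.

Lemma pfun_bas_transfer_le :
  [set: pfun_bas (transfer F G g)] #<= [set: pfun_bas g].
Proof.
have [p gp pg] := least_card_attained (fun p : set (set X2) => set_type p)
  (ex_intro _ _ (partition_for_set1 g)).
apply: card_le_trans pg.
apply: card_le_trans (least_card_le _ _ (partition_for_transfer gp)) _.
apply: (@set_type_sub_image_le _ _ transfer_piece) => _ [U [pU _] <-].
by exists U.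
Qed.

End Transfer.

Theorem theorem5p12 (X1 Y1 X2 Y2 : topologicalType)
    (P : problem X1 Y1) (Q : problem X2 Y2) :
  le2 P Q -> ecard_le (bas P) (bas Q).
Proof.
move=> [F [G [Fc Gc FGP]]]; rewrite /bas.
(* If [Q] is empty, its value is the top element [None]. Otherwise any [g] in [Q] yields an element
   of [P], so both values are genuine cardinals. *)
case: (pselect (Q !=set0)) => [Q0|nQ0]; last by case: pselect.
case: pselect => [P0|nP0] /=; last first.
  by have [g Qg] := Q0; apply: nP0; exists (transfer F G g); exact: FGP.
(* A minimising [g] suffices: its transfer belongs to [P] and so bounds the minimum over [P] from
   above. *)
have [g Qg gQ] := least_card_attained (@pfun_bas X2 Y2) Q0.
apply: card_le_trans gQ.
apply: card_le_trans (pfun_bas_transfer_le g Fc Gc).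
by apply: least_card_le; exact: FGP.
Qed.
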